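(* Let $1\le k\le n$ and let $\alpha_k\le\cdots\le\alpha_n$ be given. Then the stepdown procedure with critical values $\alpha_i$, $k\le i\le n$, is equivalent to the closed testing procedure with critical values $\beta_{i,|I|}=\alpha_{n-|I|+k}$, $k\le i\le|I|$, $k\le|I|\le n$.
   Context: Setting: $H_1,\dots,H_n$ are null hypotheses with $p$-values $P_1,\dots,P_n$. The ordered $p$-values are $P_{(1)}\le\cdots\le P_{(n)}$ with associated hypotheses $H_{(1)},\dots,H_{(n)}$; the same ordering is used by all procedures. For $I\subset\{1,\dots,n\}$ with $|I|\ge k$, $H_I=\bigcap_{i\in I}H_i$ and $P_{1:I}\le\cdots\le P_{|I|:I}$ are the ordered values of $P_i$, $i\in I$. Closed testing procedure with critical values $\beta_{i,|I|}$: the local test of $H_I$ rejects $H_I$ iff $P_{j:I}\le\beta_{j,|I|}$ for at least one $j\in\{k,\dots,|I|\}$. The closed testing procedure automatically rejects $H_{(1)},\dots,H_{(k-1)}$, and it rejects any other $H_i$ iff $H_I$ is rejected by its local test for all $I\subset\{1,\dots,n\}$ with $|I|\ge k$, $i\in I$ and $P_i\ge P_{k:I}$. Stepdown procedure with critical values $\alpha_k\le\cdots\le\alpha_n$: if $P_{(k)}>\alpha_k$, reject $H_{(1)},\dots,H_{(k-1)}$ only; otherwise reject $H_{(1)},\dots,H_{(r)}$, where $r\ge k$ is the largest index satisfying $P_{(k)}\le\alpha_k,\dots,P_{(r)}\le\alpha_r$. Two procedures are equivalent if they always reject (and accept) the same individual hypotheses. *)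

(* Defs.v *)
From mathcomp Require Import all_boot all_order all_algebra all_fingroup reals.

Set Implicit Arguments.
Unset Strict Implicit.
Unset Printing Implicit Defensive.

Import Order.TTheory GRing.Theory Num.Theory.

Local Open Scope ring_scope.

(* The hypotheses H_1, ..., H_n are represented by their indices in 'I_n, and
   P i is the observed p-value of H_i.  Ranks and critical-value indices are
   1-based natural numbers, as in P_(1) <= ... <= P_(n). *)

(* P_{j:I}, meaningful for 1 <= j <= #|I|. *)
Definition order_stat (R : realType) (n : nat) (P : 'I_n -> R)
    (I : {set 'I_n}) (j : nat) : R :=
  nth 0 (sort <=%R [seq P i | i in I]) j.-1.

(* s enumerates the hypotheses as H_(1), ..., H_(n): H_(j) is the hypothesis of
   index s (j - 1), and has p-value P_(j).  Several s qualify when there are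
   ties. *)
Definition is_ordering (R : realType) (n : nat) (P : 'I_n -> R) (s : 'S_n) :
    Prop :=
  forall j : 'I_n, P (s j) = order_stat P [set: 'I_n] j.+1.

(* {H_(1), ..., H_(r)} *)
Definition first_hyps (n : nat) (s : 'S_n) (r : nat) : {set 'I_n} :=
  [set s j | j : 'I_n & (j.+1 <= r)%N].

(* A procedure maps p-values and their ordering to the rejected hypotheses. *)
Definition procedure (R : realType) (n : nat) : Type :=
  ('I_n -> R) -> 'S_n -> {set 'I_n}.

Definition equivalent (R : realType) (n : nat) (phi psi : procedure R n) :
    Prop :=
  forall (P : 'I_n -> R) (s : 'S_n), is_ordering P s -> phi P s = psi P s.

(* beta j m is the critical value compared with P_{j:I} when #|I| = m. *)
Definition local_test (R : realType) (n k : nat) (beta : nat -> nat -> R)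
    (P : 'I_n -> R) (I : {set 'I_n}) : bool :=
  [exists j : 'I_n.+1,
     (k <= j <= #|I|)%N && (order_stat P I j <= beta j #|I|)].

Definition closed_testing (R : realType) (n k : nat)
    (beta : nat -> nat -> R) : procedure R n :=
  fun P s =>
    first_hyps s k.-1 :|:
    [set i | [forall I : {set 'I_n},
       [&& (k <= #|I|)%N, i \in I & order_stat P I k <= P i]
         ==> local_test k beta P I]].

(* The maximum is taken over a nonempty set: k itself qualifies in the second
   branch. *)
Definition stepdown (R : realType) (n k : nat) (alpha : nat -> R) :
    procedure R n :=
  fun P s =>
    if alpha k < order_stat P [set: 'I_n] k then first_hyps s k.-1
    else first_hyps s
      (\max_(r < n.+1 | (k <= r)%N &&
         [forall j : 'I_n.+1, (k <= j <= r)%N ==>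
            (order_stat P [set: 'I_n] j <= alpha j)]) r).

(* Main.v *)
Require Import Defs.
From mathcomp Require Import all_boot all_order all_algebra all_fingroup reals.
From mathcomp Require Import zify.

Set Implicit Arguments.
Unset Strict Implicit.
Unset Printing Implicit Defensive.

Import Order.TTheory GRing.Theory Num.Theory.

Local Open Scope ring_scope.

(** Every comparison of an order statistic with a threshold is a counting
    statement: P_{j:I} <= x iff at least j members of I have p-value at most x
    ([order_stat_le]).  This reading is insensitive to ties.

    Fix the hypothesis i of rank r; the first k - 1 are rejected by both
    procedures, so let r >= k.  As the critical values of H_I do not depend on
    the rank j in I, its local test amounts to comparing P_{k:I} with
    alpha_(n - #|I| + k).  The stepdown procedure rejects i iff
    P_(j) <= alpha_j for every j in [k, r] ([stepdown_rejects]).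

    Suppose that this holds, and let I contain i, with P_{k:I} <= P_i.  Put
    q = n - #|I| + k.  Only n - #|I| hypotheses lie outside I, so k of the q
    smallest p-values belong to I, and P_{k:I} <= P_(q)
    ([order_stat_sub_le]).  If q <= r, then P_(q) <= alpha_q; if q > r, then
    P_{k:I} <= P_(r) <= alpha_r <= alpha_q.  In both cases H_I is rejected
    ([order_stat_le_critical]).

    Conversely, suppose that P_(j) > alpha_j for some j in [k, r].  Let I be made
    of the hypotheses of rank less than k and of those of rank at least j
    ([skip_ranks]).  It has n - j + k elements, so its critical value is alpha_j.
    Its members with p-value at most alpha_j all have rank less than k, so
    P_{l:I} > alpha_j for all l >= k ([order_stat_skip_ranks_gt]), while i is in
    I and P_{k:I} <= P_i ([order_stat_skip_ranks_le]).  Hence H_I prevents the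
    closed testing procedure from rejecting i. *)

Lemma order_stat_le (R : realType) (n : nat) (P : 'I_n -> R) (I : {set 'I_n})
    (j : nat) (x : R) :
  (0 < j <= #|I|)%N ->
  (order_stat P I j <= x) = (j <= #|[set i in I | (P i <= x)%R]|)%N.
Proof.
case: j => [//|j] /= j_lt; rewrite /order_stat /=.
set t := sort _ _.
have t_sorted : sorted <=%O t by apply: sort_le_sorted.
have size_t : size t = #|I| by rewrite size_sort size_map -cardE.
have -> : #|[set i in I | P i <= x]| = count (<= x) t.
  rewrite /t count_sort count_map cardE.
  rewrite (_ : enum _ = [seq i <- enum I | P i <= x]) ?size_filter //.
  rewrite /enum_mem -filter_predI; apply: eq_filter => i /=.
  by rewrite !inE andbC.
case: ltnP => [/nth_count_le -> // | le_j].
by apply/negbTE; rewrite -ltNge nth_count_gt // le_j size_t.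
Qed.

Lemma order_stat_le_subset (R : realType) (n : nat) (P : 'I_n -> R)
    (I A : {set 'I_n}) (j : nat) (x : R) :
  A \subset I -> (0 < j <= #|A|)%N -> {in A, forall i, P i <= x} ->
  order_stat P I j <= x.
Proof.
move=> AI /andP[j_gt0 jA] Ax; rewrite order_stat_le; last first.
  by rewrite j_gt0 (leq_trans jA) ?subset_leq_card.
apply: leq_trans jA (subset_leq_card _); apply/subsetP => i iA.
by rewrite inE (subsetP AI) //= Ax.
Qed.

Lemma leq_cardI (T : finType) (A B : {set T}) :
  (#|A| + #|B| - #|T| <= #|A :&: B|)%N.
Proof. by rewrite leq_subLR -cardsUI leq_add2r max_card. Qed.

Lemma mem_first_hyps (n : nat) (s : 'S_n) (r : nat) (p : 'I_n) :
  (s p \in first_hyps s r) = (p < r)%N.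
Proof. by rewrite /first_hyps mem_imset ?inE //; apply: perm_inj. Qed.

Lemma card_first_hyps (n : nat) (s : 'S_n) (r : nat) :
  (r <= n)%N -> #|first_hyps s r| = r.
Proof.
move=> r_le_n; rewrite card_imset; last exact: perm_inj.
by rewrite cardsE -sum1_card -(big_ord_widen n (fun=> 1%N)) // sum1_card card_ord.
Qed.

Lemma first_hyps_sub (n : nat) (s : 'S_n) (q r : nat) :
  (q <= r)%N -> first_hyps s q \subset first_hyps s r.
Proof.
move=> qr; apply/subsetP => _ /imsetP[p + ->].
by rewrite inE mem_first_hyps => /leq_trans ->.
Qed.

Lemma ordering_le (R : realType) (n : nat) (P : 'I_n -> R) (s : 'S_n)
    (a b : 'I_n) :
  is_ordering P s -> (a <= b)%N -> P (s a) <= P (s b).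
Proof.
move=> s_ordering ab; rewrite !s_ordering /order_stat /=.
by apply: (sorted_leq_nth le_trans le_refl 0 (sort_le_sorted _)) => //;
  rewrite inE size_sort size_map -cardE cardsT card_ord.
Qed.

Lemma first_hyps_le (R : realType) (n : nat) (P : 'I_n -> R) (s : 'S_n)
    (p : 'I_n) (r : nat) :
  is_ordering P s -> (r <= p.+1)%N ->
  {in first_hyps s r, forall i, P i <= P (s p)}.
Proof.
move=> s_ordering rp _ /imsetP[a + ->]; rewrite inE => ar.
exact: ordering_le s_ordering (leq_trans ar rp).
Qed.

(** At most n - #|I| of the n - #|I| + k smallest p-values lie outside I, which
    leaves k of them in I. *)
Lemma order_stat_sub_le (R : realType) (n : nat) (P : 'I_n -> R) (s : 'S_n)
    (I : {set 'I_n}) (k : nat) :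
  is_ordering P s -> (0 < k <= #|I|)%N ->
  order_stat P I k <= order_stat P [set: 'I_n] (n - #|I| + k).
Proof.
move=> s_ordering /andP[k_gt0 kI].
have In : (#|I| <= n)%N by rewrite -[leqRHS]card_ord max_card.
have q_lt : ((n - #|I| + k).-1 < n)%N by lia.
have qE : (n - #|I| + k)%N = (Ordinal q_lt).+1 by rewrite /=; lia.
rewrite {1}qE -s_ordering.
apply: (@order_stat_le_subset _ _ _ _ (first_hyps s (Ordinal q_lt).+1 :&: I)).
- exact: subsetIr.
- rewrite k_gt0 -qE; apply: leq_trans (leq_cardI _ _).
  by rewrite card_ord card_first_hyps; lia.
- by move=> i /setIP[+ _]; apply: first_hyps_le.
Qed.

(** The first k - 1 hypotheses are covered as well: there the condition is
    vacuous. *)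
Lemma stepdown_rejects (R : realType) (n k : nat) (alpha : nat -> R)
    (P : 'I_n -> R) (s : 'S_n) (p : 'I_n) :
  (k <= n)%N ->
  (s p \in stepdown k alpha P s) <->
  (forall j : nat, (k <= j <= p.+1)%N ->
     order_stat P [set: 'I_n] j <= alpha j).
Proof.
move=> k_le_n; rewrite /stepdown; case: ltP => [fail_k | pass_k].
  rewrite mem_first_hyps; split=> [p_lt j j_in|pass]; first by exfalso; lia.
  case: ltnP => // p_ge; have kp : (k <= p.+1)%N by lia.
  by have := pass k; rewrite leqnn kp leNgt fail_k => /(_ isT).
rewrite mem_first_hyps; split=> [p_lt j /andP[kj jp]|pass]; last first.
  have r_bound : (maxn k p.+1 < n.+1)%N by have := ltn_ord p; lia.
  apply: leq_trans (leq_maxr k p.+1) _.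
  apply: (@leq_bigmax_cond _ _ (fun r : 'I_n.+1 => r : nat)
            (Ordinal r_bound)).
  rewrite /= leq_maxl; apply/forallP => j; apply/implyP => /andP[kj].
  rewrite leq_max => /orP[jk | jp]; last by apply: pass; rewrite kj.
  by rewrite (_ : (j : nat) = k) //; lia.
(* The maximum is attained, its range being nonempty, so it is itself an
   admissible r. *)
move: p_lt; case: (@eq_bigmax_cond _ [pred r : 'I_n.+1 | (k <= r)%N &&
         [forall j : 'I_n.+1, (k <= j <= r)%N ==>
            (order_stat P [set: 'I_n] j <= alpha j)]]
         (fun r : 'I_n.+1 => r : nat)).
  have k_bound : (k < n.+1)%N by [].
  apply/card_gt0P; exists (Ordinal k_bound); rewrite inE /= leqnn /=.
  by apply/forallP => l; apply/implyP => /anti_leq <-.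
move=> r; rewrite inE => /andP[_ /forallP pass] -> p_lt.
have j_bound : (j < n.+1)%N by have := ltn_ord p; lia.
by apply: (implyP (pass (Ordinal j_bound))); rewrite /= kj (leq_trans jp).
Qed.

(** Without the ranks k, ..., j - 1, only k - 1 hypotheses precede H_(j), so the
    k-th order statistic of the set is P_(j). *)
Definition skip_ranks (n : nat) (s : 'S_n) (k j : nat) : {set 'I_n} :=
  first_hyps s k.-1 :|: ~: first_hyps s j.-1.

Lemma card_skip_ranks (n : nat) (s : 'S_n) (k j : nat) :
  (0 < k <= j)%N -> (j <= n)%N -> #|skip_ranks s k j| = (n - j + k)%N.
Proof.
move=> /andP[k_gt0 kj] jn; rewrite /skip_ranks cardsU.
have -> : first_hyps s k.-1 :&: ~: first_hyps s j.-1 = set0.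
  by apply/eqP; rewrite setI_eq0 disjoints_subset setCK first_hyps_sub //; lia.
have := cardsC (first_hyps s j.-1).
by rewrite cards0 card_ord !card_first_hyps => [cardC||]; lia.
Qed.

(** Two bounds on P_{k:I} are available: P_(n - #|I| + k), and the p-value of
    [s p], which is P_(p + 1).  The one of smaller rank is among the order
    statistics that pass, and its critical value is at most
    alpha_(n - #|I| + k). *)
Lemma order_stat_le_critical (R : realType) (n k : nat) (alpha : nat -> R)
    (P : 'I_n -> R) (s : 'S_n) (p : 'I_n) (I : {set 'I_n}) :
  (forall i j : nat,
     (k <= i)%N -> (i <= j)%N -> (j <= n)%N -> alpha i <= alpha j) ->
  is_ordering P s ->
  (forall j : nat, (k <= j <= p.+1)%N ->
     order_stat P [set: 'I_n] j <= alpha j) ->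
  (0 < k <= p.+1)%N -> (k <= #|I|)%N -> order_stat P I k <= P (s p) ->
  order_stat P I k <= alpha (n - #|I| + k)%N.
Proof.
move=> alpha_mono s_ord pass /andP[k_gt0 kp] kI PkI.
have In : (#|I| <= n)%N by rewrite -[leqRHS]card_ord max_card.
have q_le_n : (n - #|I| + k <= n)%N by lia.
case: (leqP (n - #|I| + k) p.+1) => [q_le | q_gt].
  apply: le_trans (order_stat_sub_le s_ord _) (pass _ _); first by rewrite k_gt0.
  by rewrite leq_addl.
apply: le_trans PkI _; rewrite s_ord.
have /pass le_alpha : (k <= p.+1 <= p.+1)%N by rewrite kp leqnn.
by apply: le_trans le_alpha (alpha_mono _ _ kp (ltnW q_gt) q_le_n).
Qed.

(** The members of rank at least j have p-value at least P_(j) > x, which leaves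
    at most k - 1 members with p-value at most x. *)
Lemma order_stat_skip_ranks_gt (R : realType) (n k j l : nat) (P : 'I_n -> R)
    (s : 'S_n) (x : R) :
  is_ordering P s -> (0 < k <= j)%N -> (j <= n)%N ->
  x < order_stat P [set: 'I_n] j ->
  (k <= l <= #|skip_ranks s k j|)%N -> x < order_stat P (skip_ranks s k j) l.
Proof.
move=> s_ord /andP[k_gt0 kj] j_n x_lt /andP[kl lI].
rewrite ltNge order_stat_le; last by rewrite lI (leq_trans k_gt0).
rewrite -ltnNge; apply: leq_trans kl.
rewrite -[leqRHS](prednK k_gt0) ltnS.
rewrite -[leqRHS](@card_first_hyps _ s); last by lia.
apply/subset_leq_card/subsetP => h; rewrite !inE => /andP[/orP[//|h_ge] h_le].
have j_lt : (j.-1 < n)%N by lia.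
move: h_ge h_le; rewrite -(permKV s h) mem_first_hyps -leqNgt => h_ge.
rewrite leNgt (lt_le_trans x_lt) //.
rewrite (_ : j = (Ordinal j_lt).+1); last by rewrite /=; lia.
by rewrite -s_ord ordering_le.
Qed.

(** The k - 1 hypotheses of smallest rank, together with [s p], are k members
    with p-value at most that of [s p]. *)
Lemma order_stat_skip_ranks_le (R : realType) (n k j : nat) (P : 'I_n -> R)
    (s : 'S_n) (p : 'I_n) :
  is_ordering P s -> (0 < k <= j)%N -> (j <= p.+1)%N ->
  order_stat P (skip_ranks s k j) k <= P (s p).
Proof.
move=> s_ord /andP[k_gt0 kj] jp; have p_n := ltn_ord p.
apply: (@order_stat_le_subset _ _ _ _ (s p |: first_hyps s k.-1)).
- rewrite subUset sub1set !inE !mem_first_hyps subsetUl; lia.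
- by rewrite cardsU1 mem_first_hyps card_first_hyps; lia.
- by move=> h /setU1P[-> // | ]; apply: (first_hyps_le s_ord); lia.
Qed.

Theorem theorem4p2 (R : realType) (n k : nat) (alpha : nat -> R)
    (k_ge1 : (1 <= k)%N) (k_le_n : (k <= n)%N)
    (alpha_mono : forall i j : nat,
       (k <= i)%N -> (i <= j)%N -> (j <= n)%N -> alpha i <= alpha j) :
  equivalent (@stepdown R n k alpha)
    (@closed_testing R n k (fun _ m => alpha (n - m + k)%N)).
Proof.
move=> P s s_ord; apply/setP => i.
have [p ->] : exists p, i = s p by exists ((s^-1)%g i); rewrite permKV.
have p_n := ltn_ord p.
rewrite [RHS]inE mem_first_hyps inE; case: ltnP => [p_lt | p_ge] /=.
  by apply/stepdown_rejects => // j j_in; exfalso; lia.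
have kp : (k <= p.+1)%N by lia.
apply/idP/forallP => [/(stepdown_rejects _ _ _ _ k_le_n) pass I | reject].
  apply/implyP => /and3P[kI _ PkI].
  have k_bound : (k < n.+1)%N by [].
  apply/existsP; exists (Ordinal k_bound); rewrite /= leqnn kI /=.
  by apply: order_stat_le_critical pass _ kI PkI; rewrite ?k_ge1.
apply/(stepdown_rejects _ _ _ _ k_le_n) => j /andP[kj jp].
have j_n : (j <= n)%N by lia.
have k0j : (0 < k <= j)%N by rewrite k_ge1.
have card_I : #|skip_ranks s k j| = (n - j + k)%N by apply: card_skip_ranks.
rewrite leNgt; apply/negP => fail_j.
have /implyP := reject (skip_ranks s k j).
rewrite order_stat_skip_ranks_le // card_I leq_addl.
rewrite in_setU in_setC !mem_first_hyps.
have -> : ~~ (p < j.-1)%N by lia.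
rewrite orbT => /(_ isT) /existsP[l] /andP[l_range].
have -> : (n - #|skip_ranks s k j| + k)%N = j by rewrite card_I; lia.
by rewrite leNgt (order_stat_skip_ranks_gt s_ord k0j j_n fail_j).
Qed.
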